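(* Let $ABC$ be a triangle and let $\omega$ be any circle with center $P$ inside triangle $ABC$. Let $\omega_a$ be the smaller of the two circles tangent to $\omega$ and to the lines $AB$ and $AC$; define $\omega_b$ and $\omega_c$ cyclically. Similarly, let $\omega_a'$ be the larger of the two circles tangent to $\omega$ and to the lines $AB$ and $AC$; define $\omega_b'$ and $\omega_c'$ cyclically. Let $O_1$ be the center of the outer Apollonius circle of $\omega_a$, $\omega_b$, $\omega_c$, and let $O_2$ be the center of the outer Apollonius circle of $\omega_a'$, $\omega_b'$, $\omega_c'$. Then the line $O_1O_2$ passes through the fixed point $I$, the incenter of triangle $ABC$.
   Context: All objects lie in the Euclidean plane. ''Cyclically'' means that $\omega_b,\omega_b'$ are defined in the same way from $\omega$ and the lines $BC$, $BA$, and $\omega_c,\omega_c'$ from $\omega$ and the lines $CA$, $CB$. The ''two circles tangent to $\omega$ and to the lines $AB$ and $AC$'' are the two such circles lying in the angle $BAC$ and externally tangent to $\omega$. The outer Apollonius circle of three circles is the circle tangent to all three and containing them, i.e. the three circles are internally tangent to it. *)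

(* Defs.v *)
From Stdlib Require Import Reals.
Open Scope R_scope.

Definition point : Type := (R * R)%type.

Definition pdist (X Y : point) : R := dist_euc (fst X) (snd X) (fst Y) (snd Y).

(* The point A + s (B - A) + t (C - A). *)
Definition affine (A B C : point) (s t : R) : point :=
  (fst A + s * (fst B - fst A) + t * (fst C - fst A),
   snd A + s * (snd B - snd A) + t * (snd C - snd A)).

(* For A = B the "line" degenerates to the single point A. *)
Definition on_line (X A B : point) : Prop :=
  exists t : R,
    X = (fst A + t * (fst B - fst A), snd A + t * (snd B - snd A)).

Definition is_triangle (A B C : point) : Prop := A <> B /\ ~ on_line C A B.

(* The closed angular region BAC, with vertex A. *)
Definition in_angle (B A C X : point) : Prop :=
  exists s t : R, 0 <= s /\ 0 <= t /\ X = affine A B C s t.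

Definition in_triangle (A B C X : point) : Prop :=
  exists s t : R, 0 <= s /\ 0 <= t /\ s + t <= 1 /\ X = affine A B C s t.

Definition inside_triangle (A B C X : point) : Prop :=
  exists s t : R, 0 < s /\ 0 < t /\ s + t < 1 /\ X = affine A B C s t.

Record circle : Type := Circle {
  center : point;
  radius : R;
  radius_gt0 : 0 < radius
}.

Definition on_circle (w : circle) (X : point) : Prop :=
  pdist (center w) X = radius w.

(* Compares the data only, so that proof irrelevance plays no role. *)
Definition distinct_circles (w1 w2 : circle) : Prop :=
  center w1 <> center w2 \/ radius w1 <> radius w2.

Definition tangent_to_line (w : circle) (A B : point) : Prop :=
  exists! X : point, on_line X A B /\ on_circle w X.

Definition externally_tangent (w1 w2 : circle) : Prop :=
  pdist (center w1) (center w2) = radius w1 + radius w2.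

(* w is internally tangent to W, i.e. W touches w and contains it. *)
Definition internally_tangent (w W : circle) : Prop :=
  radius w < radius W /\ pdist (center W) (center w) = radius W - radius w.

Definition is_incenter (A B C I : point) : Prop :=
  exists w : circle,
    center w = I /\
    (forall X, on_circle w X -> in_triangle A B C X) /\
    tangent_to_line w A B /\ tangent_to_line w B C /\ tangent_to_line w C A.

Definition tangent_in_angle (w : circle) (B A C : point) (v : circle) : Prop :=
  tangent_to_line v A B /\ tangent_to_line v A C /\
  (forall X, on_circle v X -> in_angle B A C X) /\
  externally_tangent v w.

(* v and v' are, respectively, the smaller and the larger circle in the angle
   BAC tangent to its sides and to w.  There are exactly two such circles when
   the center of w is interior to the angle and A lies outside w; if A lies in
   the closed disk of w there is only one, and no pair satisfies this. *)
Definition smaller_larger_tangent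
    (w : circle) (B A C : point) (v v' : circle) : Prop :=
  tangent_in_angle w B A C v /\ tangent_in_angle w B A C v' /\
  radius v < radius v'.

(* Two coinciding circles do not determine an outer Apollonius circle (there
   is a one-parameter family of candidates), hence the distinctness. *)
Definition outer_apollonius (W w1 w2 w3 : circle) : Prop :=
  (distinct_circles w1 w2 /\ distinct_circles w2 w3 /\
   distinct_circles w3 w1) /\
  internally_tangent w1 W /\ internally_tangent w2 W /\
  internally_tangent w3 W.

(* Main.v *)
(** A circle with center X and signed radius x is the point (X, x) of the Lorentz
    space R^(2,1), where internal tangency means that the difference is isotropic.
    Put the origin at the incircle (I, r).  The circles inscribed in the angle at A
    are then the multiples of the vector from the incircle to the point-circle
    (A, 0), and those touching w externally lie on the isotropic cone of
    p = (P, -rho), rho being the radius of w.  The inversion of power <p, p> in the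
    incircle preserves this cone and therefore exchanges the smaller and the larger
    tangent circle at each vertex.  So it maps the isotropic cone of W1 to that of
    W2, and W2 is a multiple of W1: I, O1, O2 are collinear. *)
Require Import Defs.
From Stdlib Require Import Reals Lra.
Open Scope R_scope.

(** * The Lorentz form on R^(2,1) and its isotropic vectors *)

Definition lor (u v : point * R) : R :=
  fst (fst u) * fst (fst v) + snd (fst u) * snd (fst v) - snd u * snd v.

Definition lscale (k : R) (u : point * R) : point * R :=
  ((k * fst (fst u), k * snd (fst u)), k * snd u).

Definition lsub (u v : point * R) : point * R :=
  ((fst (fst u) - fst (fst v), snd (fst u) - snd (fst v)), snd u - snd v).

Definition isotropic (u : point * R) : Prop := lor u u = 0.

(** Linear independence, stated through the nondegenerate form: a vector is determined by its three
    products with [u], [v], [w]. *)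
Definition spans (u v w : point * R) : Prop :=
  forall x, lor u x = 0 -> lor v x = 0 -> lor w x = 0 -> x = (0, 0, 0).

Lemma lor_sub_r u v w : lor u (lsub v w) = lor u v - lor u w.
Proof. unfold lor, lsub; simpl; ring. Qed.

Lemma lor_scale_r k u v : lor u (lscale k v) = k * lor u v.
Proof. unfold lor, lscale; simpl; ring. Qed.

Lemma lor_scale_l k u v : lor (lscale k u) v = k * lor u v.
Proof. unfold lor, lscale; simpl; ring. Qed.

Lemma lor_sub_sq u v : lor (lsub u v) (lsub u v) = lor u u - 2 * lor u v + lor v v.
Proof. unfold lor, lsub; simpl; ring. Qed.

Lemma lsub_eq0 u v : lsub u v = (0, 0, 0) -> u = v.
Proof.
  destruct u as [[a b] c], v as [[a' b'] c']; unfold lsub; simpl.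
  intro H; injection H as H1 H2 H3.
  f_equal; [f_equal|]; lra.
Qed.

(** In signature (2,1) totally isotropic subspaces have dimension at most 1. The hypotheses give
    equality in Cauchy-Schwarz for the planar parts, which are therefore parallel. *)
Lemma isotropic_orthogonal f g :
  isotropic f -> isotropic g -> lor f g = 0 -> f <> (0, 0, 0) ->
  exists k, g = lscale k f.
Proof.
  destruct f as [[x y] z], g as [[a b] c]; unfold isotropic, lor, lscale; simpl.
  intros Hf Hg Hfg Hn.
  assert (Hz : z <> 0).
  { intro Hz; subst z; apply Hn.
    assert (x = 0) by nra. assert (y = 0) by nra. now subst. }
  assert (Hc : a * y - b * x = 0).
  { apply Rsqr_0_uniq; unfold Rsqr.
    replace ((a * y - b * x) * (a * y - b * x))
      with ((a*a+b*b)*(x*x+y*y) - (x*a+y*b)*(x*a+y*b)) by ring.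
    replace (a*a+b*b) with (c*c) by lra.
    replace (x*x+y*y) with (z*z) by lra.
    replace (x*a+y*b) with (z*c) by lra. ring. }
  exists (c / z).
  assert (Ha : a * (z * z) = c * z * x).
  { replace (z * z) with (x*x+y*y) by lra.
    replace (c * z) with (x*a+y*b) by lra.
    replace (a * (x*x+y*y)) with ((x*a+y*b)*x + y*(a*y-b*x)) by ring. rewrite Hc; ring. }
  assert (Hb : b * (z * z) = c * z * y).
  { replace (z * z) with (x*x+y*y) by lra.
    replace (c * z) with (x*a+y*b) by lra.
    replace (b * (x*x+y*y)) with ((x*a+y*b)*y - x*(a*y-b*x)) by ring. rewrite Hc; ring. }
  assert (Hzz : z * z <> 0) by nra.
  f_equal; [f_equal|].
  - apply (Rmult_eq_reg_r (z * z)); [|assumption]. rewrite Ha; field; assumption.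
  - apply (Rmult_eq_reg_r (z * z)); [|assumption]. rewrite Hb; field; assumption.
  - field; assumption.
Qed.

Lemma lsub_add u v w k : lsub u v = lscale k w ->
  forall x, lor u x = lor v x + k * lor w x.
Proof.
  intros H x.
  replace (lor u x) with (lor v x + lor (lsub u v) x)
    by (unfold lor, lsub; simpl; ring).
  now rewrite H, lor_scale_l.
Qed.

(* The Lorentzian cross product, orthogonal to u and v with respect to [lor]. *)
Definition cross (u v : point * R) : point * R :=
  ((snd (fst u) * snd v - snd u * snd (fst v),
    snd u * fst (fst v) - fst (fst u) * snd v),
   - (fst (fst u) * snd (fst v) - snd (fst u) * fst (fst v))).

Lemma lor_cross_l u v : lor u (cross u v) = 0.
Proof. unfold lor, cross; simpl; ring. Qed.

Lemma lor_cross_r u v : lor v (cross u v) = 0.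
Proof. unfold lor, cross; simpl; ring. Qed.

(** A vanishing cross product makes [u] proportional to the nonzero [v]. *)
Lemma cross_eq0 u v : cross u v = (0, 0, 0) -> isotropic v -> v <> (0, 0, 0) ->
  isotropic u.
Proof.
  destruct u as [[a b] c], v as [[x y] z]; unfold cross, isotropic, lor; simpl.
  intros H Hv Hn; injection H as H1 H2 H3.
  assert (Hz : z <> 0).
  { intro Hz; subst z; apply Hn.
    assert (x = 0) by nra. assert (y = 0) by nra. now subst. }
  apply (Rmult_eq_reg_r (z * z)); [|nra].
  replace ((a * a + b * b - c * c) * (z * z))
    with ((a*z)*(a*z) + (b*z)*(b*z) - c*c*(z*z)) by ring.
  replace (a * z) with (c * x) by lra.
  replace (b * z) with (c * y) by lra.
  replace (z * z) with (x*x+y*y) by lra. ring.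
Qed.

(** * Inversion exchanging the two tangent circles at each vertex *)

(** Vieta: [t] and [t'] are the two roots of the quadratic that puts [lscale t u] on the isotropic
    cone of [p]. *)
Lemma root_relations u p t t' :
  t <> t' ->
  isotropic (lsub (lscale t u) p) -> isotropic (lsub (lscale t' u) p) ->
  lor u u * (t * t') = lor p p.
Proof.
  unfold isotropic; rewrite !lor_sub_sq, !lor_scale_l, !lor_scale_r.
  intros Ht H H'.
  assert (Hs : lor u u * (t + t') = 2 * lor u p).
  { apply (Rmult_eq_reg_r (t - t')); [|lra]. lra. }
  nra.
Qed.

(* Both identities are differences of equations quadratic in t': the first of the
   cones of p and w2, the second of the cone of p and the inverted cone of w1. *)
Lemma vertex_relations u p w1 w2 t t' :
  t <> 0 -> t <> t' ->
  isotropic (lsub (lscale t u) p) -> isotropic (lsub (lscale t' u) p) ->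
  isotropic (lsub (lscale t u) w1) -> isotropic (lsub (lscale t' u) w2) ->
  2 * t' * lor u (lsub p w2) = lor p p - lor w2 w2 /\
  2 * t' * lor u (lsub (lscale (lor w1 w1) p) (lscale (lor p p) w1))
    = lor p p * (lor w1 w1 - lor p p).
Proof.
  intros Ht0 Htt H H' H1 H2.
  pose proof (root_relations u p t t' Htt H H') as Hc.
  revert H H' H1 H2; unfold isotropic.
  rewrite !lor_sub_sq, !lor_sub_r, !lor_scale_l, !lor_scale_r.
  intros H H' H1 H2.
  split; [lra|].
  (* The cone of [w1] after the inversion of power [lor p p], which sends [lscale t u] to
     [lscale t' u]. *)
  assert (H1' : lor w1 w1 * (t' * t' * lor u u) - 2 * t' * lor p p * lor u w1
                + lor p p * lor p p = 0).
  { apply (Rmult_eq_reg_r t); [|assumption].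
    transitivity (t' * lor p p * (t * (t * lor u u) - 2 * (t * lor u w1) + lor w1 w1)).
    - rewrite <- Hc; ring.
    - rewrite H1; ring. }
  transitivity (lor w1 w1 * (- (t' * (t' * lor u u) - 2 * (t' * lor u p) + lor p p))
     + (lor w1 w1 * (t' * t' * lor u u) - 2 * t' * lor p p * lor u w1
                + lor p p * lor p p) + lor p p * (lor w1 w1 - lor p p)); [ring|].
  rewrite H', H1'; ring.
Qed.

(** By [vertex_relations], [f = p - w2] and [g = m1 p - c w1] have proportional products with the
    three vertex vectors, so they are proportional. Comparing norms then identifies [w2] as the
    inverse of [w1]. *)
Lemma apollonius_inverse ua ub uc p w1 w2 ta tb tc ta' tb' tc' :
  spans ua ub uc ->
  lor ua ua <> 0 -> lor ub ub <> 0 -> lor uc uc <> 0 ->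
  ta <> ta' -> tb <> tb' -> tc <> tc' ->
  isotropic (lsub (lscale ta ua) p) -> isotropic (lsub (lscale ta' ua) p) ->
  isotropic (lsub (lscale tb ub) p) -> isotropic (lsub (lscale tb' ub) p) ->
  isotropic (lsub (lscale tc uc) p) -> isotropic (lsub (lscale tc' uc) p) ->
  isotropic (lsub (lscale ta ua) w1) -> isotropic (lsub (lscale ta' ua) w2) ->
  isotropic (lsub (lscale tb ub) w1) -> isotropic (lsub (lscale tb' ub) w2) ->
  isotropic (lsub (lscale tc uc) w1) -> isotropic (lsub (lscale tc' uc) w2) ->
  ~ (ta = 0 /\ tb = 0) -> ~ (tb = 0 /\ tc = 0) -> ~ (tc = 0 /\ ta = 0) ->
  ~ (ta' = 0 /\ tb' = 0) -> ~ (tb' = 0 /\ tc' = 0) -> ~ (tc' = 0 /\ ta' = 0) ->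
  w1 <> p -> w2 <> p ->
  exists k, k <> 1 /\ w2 = lscale k w1.
Proof.
  intros Hsp Na Nb Nc Ta Tb Tc Pa Pa' Pb Pb' Pc Pc' A1 A2 B1 B2 C1 C2
    Z1 Z2 Z3 Z1' Z2' Z3' Hw1 Hw2.
  pose proof (root_relations _ _ _ _ Ta Pa Pa') as Ra.
  pose proof (root_relations _ _ _ _ Tb Pb Pb') as Rb.
  pose proof (root_relations _ _ _ _ Tc Pc Pc') as Rc.
  (* Otherwise 0 is a parameter of one of the two circles at each vertex, hence
     twice in one of the two triples. *)
  assert (Hc : lor p p <> 0).
  { intro H0; rewrite H0 in *.
    apply Rmult_integral in Ra, Rb, Rc.
    destruct Ra as [Ra|Ra]; [tauto|]. destruct Rb as [Rb|Rb]; [tauto|].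
    destruct Rc as [Rc|Rc]; [tauto|].
    apply Rmult_integral in Ra, Rb, Rc. tauto. }
  assert (Hnz : forall n t t', n * (t * t') = lor p p -> t <> 0 /\ t' <> 0).
  { intros n t t' E; split; intro E0; subst; apply Hc; rewrite <- E; ring. }
  destruct (Hnz _ _ _ Ra) as [ta0 ta0'], (Hnz _ _ _ Rb) as [tb0 tb0'],
    (Hnz _ _ _ Rc) as [tc0 tc0'].
  destruct (vertex_relations _ _ _ _ _ _ ta0 Ta Pa Pa' A1 A2) as [Fa Ga].
  destruct (vertex_relations _ _ _ _ _ _ tb0 Tb Pb Pb' B1 B2) as [Fb Gb].
  destruct (vertex_relations _ _ _ _ _ _ tc0 Tc Pc Pc' C1 C2) as [Fc Gc].
  set (c := lor p p) in *.
  set (m1 := lor w1 w1) in *. set (m2 := lor w2 w2) in *.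
  set (f := lsub p w2) in *. set (g := lsub (lscale m1 p) (lscale c w1)) in *.
  assert (Hf0 : f <> (0, 0, 0)) by (intro E; apply lsub_eq0 in E; auto).
  assert (Hz : forall u t, t <> 0 -> forall x, 2 * t * lor u x = 0 -> lor u x = 0).
  { clear; intros u t Ht x E. apply Rmult_integral in E; destruct E; [lra|assumption]. }
  assert (Hcm2 : c - m2 <> 0).
  { intro E; rewrite E in Fa, Fb, Fc. apply Hf0, Hsp;
    [apply (Hz _ _ ta0') | apply (Hz _ _ tb0') | apply (Hz _ _ tc0')]; assumption. }
  (* The products of [f] and [g] with [2 t' u] are the same two constants at all three vertices. *)
  assert (Hgf : lscale (c - m2) g = lscale (c * (m1 - c)) f).
  { apply lsub_eq0, Hsp; [apply (Hz _ _ ta0') | apply (Hz _ _ tb0') | apply (Hz _ _ tc0')];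
    rewrite lor_sub_r, !lor_scale_r, Rmult_minus_distr_l.
    - transitivity ((c - m2) * (2 * ta' * lor ua g) - c * (m1 - c) * (2 * ta' * lor ua f));
        [ring | rewrite Fa, Ga; ring].
    - transitivity ((c - m2) * (2 * tb' * lor ub g) - c * (m1 - c) * (2 * tb' * lor ub f));
        [ring | rewrite Fb, Gb; ring].
    - transitivity ((c - m2) * (2 * tc' * lor uc g) - c * (m1 - c) * (2 * tc' * lor uc f));
        [ring | rewrite Fc, Gc; ring]. }
  (* If p and w2 were tangent, the three primed points would lie on the isotropic
     line through p and w2, against their independence. *)
  assert (Hff : lor f f <> 0).
  { intro Hff.
    assert (Hpf : 2 * lor p f = c - m2).
    { revert Hff; unfold f, c, m2; rewrite lor_sub_sq, lor_sub_r; clear; lra. }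
    assert (Hline : forall u t, isotropic (lsub (lscale t u) p) ->
              2 * t * lor u f = c - m2 -> t <> 0 ->
              lor u (cross p f) = 0).
    { intros u t Hi He Ht.
      destruct (isotropic_orthogonal f (lsub (lscale t u) p)) as [k Hk]; auto.
      { replace (lor f (lsub (lscale t u) p)) with (t * lor u f - lor p f)
          by (unfold lor, lsub, lscale; simpl; ring). clear - Hpf He. lra. }
      pose proof (lsub_add _ _ _ _ Hk (cross p f)) as E.
      rewrite lor_cross_l, lor_cross_r, lor_scale_l in E.
      apply (Rmult_eq_reg_l t); [clear - E; lra|assumption]. }
    apply Hc, (cross_eq0 p f); auto.
    apply Hsp; [apply (Hline ua ta') | apply (Hline ub tb') | apply (Hline uc tc')];
      assumption. }
  (* Equality would annihilate the right side of [Hgf], forcing [w1 = p]. *)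
  assert (Hm1c : m1 <> c).
  { intro E; apply Hw1; symmetry; apply lsub_eq0.
    revert Hgf Hc; unfold g, lsub, lscale; rewrite E; clear -Hcm2; simpl.
    intros Hgf Hc; injection Hgf as E1 E2 E3.
    assert (G : forall x y d, (c - m2) * (c * x - c * y) = c * (c - c) * d -> x - y = 0).
    { intros x y d Exy. apply (Rmult_eq_reg_l (c - m2)); [|assumption].
      apply (Rmult_eq_reg_l c); [clear - Exy; lra|assumption]. }
    f_equal; [f_equal|]; eapply G; eassumption. }
  (* Take norms in [c w1 = m1 p - g], scaled by [c - m2], with [g] eliminated by [Hgf]. The two
     sides differ by [c * (m1 - c) * lor f f * (m1 * m2 - c * c)]. *)
  assert (Hm : m1 * m2 = c * c).
  { assert (E : lor (lscale (c * (c - m2)) w1) (lscale (c * (c - m2)) w1)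
       = lor (lsub (lscale (m1 * (c - m2)) p) (lscale (c - m2) g))
             (lsub (lscale (m1 * (c - m2)) p) (lscale (c - m2) g))).
    { unfold g, lor, lsub, lscale; simpl; ring. }
    rewrite Hgf in E.
    rewrite lor_sub_sq, !lor_scale_l, !lor_scale_r in E.
    fold c m1 in E.
    assert (Epf : lor p f = c - lor p w2) by apply lor_sub_r.
    assert (Eff : lor f f = c - 2 * lor p w2 + m2) by apply lor_sub_sq.
    rewrite Epf, Eff in E. rewrite Eff in Hff.
    set (b := lor p w2) in *.
    apply (Rmult_eq_reg_l (c * (m1 - c) * (c - 2 * b + m2))).
    2: { repeat apply Rmult_integral_contrapositive_currified; auto using Rminus_eq_contra. }
    clear - E. lra. }
  assert (Hm1 : m1 <> 0).
  { intro E; rewrite E in Hm; apply Hc, Rsqr_0_uniq; unfold Rsqr; rewrite <- Hm; ring. }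
  (* Inversion of power [c] multiplies [w1] by [c / lor w1 w1]. *)
  exists (c / m1). split.
  { intro E; apply Hm1c. apply (Rmult_eq_compat_r m1) in E. field_simplify in E; auto. }
  revert Hgf; unfold g, f, lsub, lscale; simpl.
  destruct w2 as [[x y] z]; simpl.
  intro Hgf; injection Hgf as E1 E2 E3.
  (* [Hgf] in one coordinate, solved for that of [w2]; by [Hm] the coefficient of [p1] cancels. *)
  assert (G : forall p1 w x, (c - m2) * (m1 * p1 - c * w) = c * (m1 - c) * (p1 - x) ->
            x = c / m1 * w).
  { intros p1 w' x' Ex.
    apply (Rmult_eq_reg_l (c * (m1 - c))); [|apply Rmult_integral_contrapositive_currified; auto using Rminus_eq_contra].
    apply (Rmult_eq_reg_l m1); [|assumption].
    replace (m1 * (c * (m1 - c) * (c / m1 * w'))) with (c * (m1 - c) * c * w') by (field; auto).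
    transitivity (m1 * (c * (m1 - c) * p1 - (c - m2) * (m1 * p1 - c * w')));
      [rewrite Ex; ring|].
    replace (m1 * (c * (m1 - c) * p1 - (c - m2) * (m1 * p1 - c * w')))
      with ((m1 * m2 - c * c) * (m1 * p1 - c * w') + c * (m1 - c) * c * w') by ring.
    rewrite Hm; ring. }
  f_equal; [f_equal|]; eapply G; eassumption.
Qed.

(** * Circles inscribed in an angle, in affine coordinates *)

Definition area2 (A B C : point) : R :=
  (fst B - fst A) * (snd C - snd A) - (snd B - snd A) * (fst C - fst A).

Definition inscribed (v : circle) (B A C : point) : Prop :=
  tangent_to_line v A B /\ tangent_to_line v A C /\
  (forall X, on_circle v X -> in_angle B A C X).

Definition cycle_of (v : circle) : point * R := (center v, radius v).

Lemma pdist_ge0 X Y : 0 <= pdist X Y.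
Proof. apply sqrt_pos. Qed.

Lemma pdist_sq X Y :
  pdist X Y * pdist X Y =
  (fst X - fst Y) * (fst X - fst Y) + (snd X - snd Y) * (snd X - snd Y).
Proof.
  unfold pdist, dist_euc; rewrite sqrt_sqrt; [reflexivity|].
  apply Rplus_le_le_0_compat; apply Rle_0_sqr.
Qed.

Lemma on_circle_sq v X :
  on_circle v X <->
  (fst (center v) - fst X) * (fst (center v) - fst X) +
  (snd (center v) - snd X) * (snd (center v) - snd X) = radius v * radius v.
Proof.
  unfold on_circle; rewrite <- pdist_sq; split; intro H; [now rewrite H|].
  pose proof (pdist_ge0 (center v) X); pose proof (radius_gt0 v); nra.
Qed.

Lemma on_line_sym X A B : on_line X A B -> on_line X B A.
Proof.
  intros [t ->]; exists (1 - t). f_equal; ring.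
Qed.

Lemma tangent_to_line_sym v A B : tangent_to_line v A B -> tangent_to_line v B A.
Proof.
  intros [X [[H1 H2] H3]]; exists X; split; [split; auto using on_line_sym|].
  intros Y [HY1 HY2]; apply H3; split; auto using on_line_sym.
Qed.

Lemma area2_rot A B C : area2 B C A = area2 A B C.
Proof. unfold area2; ring. Qed.

Lemma triangle_area A B C : is_triangle A B C -> area2 A B C <> 0.
Proof.
  destruct A as [ax ay], B as [bx b_y], C as [cx cy]; unfold area2; simpl.
  intros [HAB Hl] HD; apply Hl.
  assert (Hd : (bx - ax) * (bx - ax) + (b_y - ay) * (b_y - ay) <> 0).
  { intro E; apply Rplus_sqr_eq_0 in E as [E1 E2]; apply HAB; f_equal; lra. }
  exists (((cx - ax) * (bx - ax) + (cy - ay) * (b_y - ay)) /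
          ((bx - ax) * (bx - ax) + (b_y - ay) * (b_y - ay))); simpl.
  set (dx := bx - ax) in *; set (dy := b_y - ay) in *.
  f_equal; apply Rminus_diag_uniq, (Rmult_eq_reg_r (dx * dx + dy * dy)); auto.
  - transitivity (- dy * (dx * (cy - ay) - dy * (cx - ax)));
      [unfold dx, dy in *; field; assumption | rewrite HD; ring].
  - transitivity (dx * (dx * (cy - ay) - dy * (cx - ax)));
      [unfold dx, dy in *; field; assumption | rewrite HD; ring].
Qed.

(** Uniqueness of the contact point makes it the foot of the perpendicular from the center; both
    sides are then the square of base times height. *)
Lemma tangent_line_height v A B :
  A <> B -> tangent_to_line v A B ->
  area2 A B (center v) * area2 A B (center v) =
  radius v * radius v *
  ((fst B - fst A) * (fst B - fst A) + (snd B - snd A) * (snd B - snd A)).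
Proof.
  destruct A as [ax ay], B as [bx b_y]; intros HAB [X [[[s Hs] HX] Hu]].
  revert Hu HX; rewrite on_circle_sq; subst X.
  unfold area2; destruct (center v) as [x y] eqn:Ev; simpl.
  set (r := radius v); set (dx := bx - ax); set (dy := b_y - ay).
  assert (Hd : dx * dx + dy * dy <> 0).
  { intro E; apply Rplus_sqr_eq_0 in E as [E1 E2].
    unfold dx, dy in *; apply HAB; f_equal; lra. }
  intros Hu HX.
  (* Parameter of the mirror image of the contact point in the foot of the perpendicular; it also
     lies on the circle. *)
  set (s' := 2 * ((x - ax) * dx + (y - ay) * dy) / (dx * dx + dy * dy) - s).
  assert (Hs' : (s + s') * (dx * dx + dy * dy) = 2 * ((x - ax) * dx + (y - ay) * dy))
    by (unfold s'; field; assumption).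
  assert (E : (ax + s * dx, ay + s * dy) = (ax + s' * dx, ay + s' * dy)).
  { apply Hu; split; [exists s'; reflexivity|].
    rewrite on_circle_sq, Ev; simpl; fold r; rewrite <- HX.
    apply Rminus_diag_uniq.
    transitivity ((s' - s) * ((s + s') * (dx * dx + dy * dy)
      - 2 * ((x - ax) * dx + (y - ay) * dy))); [ring | rewrite Hs'; ring]. }
  injection E as E1 E2.
  assert (Hdot : s * (dx * dx + dy * dy) = (x - ax) * dx + (y - ay) * dy).
  { assert (F1 : (s - s') * dx = 0) by lra. assert (F2 : (s - s') * dy = 0) by lra.
    assert (F : (s - s') * (dx * dx + dy * dy) = 0)
      by (transitivity ((s - s') * dx * dx + (s - s') * dy * dy);
            [ring | rewrite F1, F2; ring]).
    lra. }
  (* Lagrange's identity for the squared determinant. *)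
  transitivity (((x - ax) * (x - ax) + (y - ay) * (y - ay)) * (dx * dx + dy * dy)
     - ((x - ax) * dx + (y - ay) * dy) * ((x - ax) * dx + (y - ay) * dy)); [ring|].
  rewrite <- HX, <- Hdot.
  transitivity (((x - ax) * (x - ax) + (y - ay) * (y - ay)
     - 2 * s * (s * (dx * dx + dy * dy)) + s * s * (dx * dx + dy * dy)) * (dx * dx + dy * dy));
    [ring|].
  rewrite Hdot at 1. ring.
Qed.

(** The center is the midpoint of a horizontal diameter, and the angle is convex. *)
Lemma center_in_angle v B A C :
  (forall X, on_circle v X -> in_angle B A C X) -> in_angle B A C (center v).
Proof.
  intro H; destruct (center v) as [x y] eqn:Ev.
  destruct (H (x + radius v, y)) as (s1 & t1 & Hs1 & Ht1 & E1).
  { apply on_circle_sq; rewrite Ev; simpl; ring. }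
  destruct (H (x - radius v, y)) as (s2 & t2 & Hs2 & Ht2 & E2).
  { apply on_circle_sq; rewrite Ev; simpl; ring. }
  exists ((s1 + s2) / 2), ((t1 + t2) / 2).
  split; [lra|]; split; [lra|].
  unfold affine in *; injection E1 as E1 E1'; injection E2 as E2 E2'.
  f_equal; lra.
Qed.

Lemma area2_neq A B C : area2 A B C <> 0 -> A <> B /\ A <> C.
Proof.
  intro H; split; intro E; apply H; subst; unfold area2; ring.
Qed.

Lemma eq_of_sq_eq a b : 0 <= a -> 0 <= b -> a * a = b * b -> a = b.
Proof. intros; nra. Qed.

(** The affine coordinates of the center are nonnegative and proportional to its distances from the
    sides, both equal to the radius. Hence a homothety at [A] of ratio [radius v / radius g] takes
    [g] to [v]. *)
Lemma inscribed_homothetic v g B A C :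
  area2 A B C <> 0 -> inscribed v B A C -> inscribed g B A C ->
  lsub (cycle_of v) (cycle_of g) =
  lscale (1 - radius v / radius g) (lsub (A, 0) (cycle_of g)).
Proof.
  intros HD [Hv1 [Hv2 Hv]] [Hg1 [Hg2 Hg]].
  destruct (area2_neq _ _ _ HD) as [HAB HAC].
  apply center_in_angle in Hv, Hg.
  apply tangent_line_height in Hv1, Hv2, Hg1, Hg2; auto.
  destruct Hv as (s & t & Hs & Ht & Ev), Hg as (s' & t' & Hs' & Ht' & Eg).
  unfold cycle_of.
  pose proof (radius_gt0 v) as Hrv; pose proof (radius_gt0 g) as Hrg.
  rewrite Ev in *; rewrite Eg in *.
  set (rv := radius v) in *; set (rg := radius g) in *.
  assert (EB : forall s t, area2 A B (affine A B C s t) = t * area2 A B C)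
    by (intros; unfold area2, affine; simpl; ring).
  assert (EC : forall s t, area2 A C (affine A B C s t) = - (s * area2 A B C))
    by (intros; unfold area2, affine; simpl; ring).
  rewrite EB in Hv1, Hg1; rewrite EC in Hv2, Hg2.
  assert (HD2 : area2 A B C * area2 A B C <> 0)
    by now apply Rmult_integral_contrapositive_currified.
  assert (Et : t * rg = t' * rv).
  { apply eq_of_sq_eq; [apply Rmult_le_pos; lra..|].
    apply (Rmult_eq_reg_r (area2 A B C * area2 A B C)); [|assumption].
    transitivity (rg * rg * (t * area2 A B C * (t * area2 A B C))); [ring|].
    rewrite Hv1.
    transitivity (rv * rv * (t' * area2 A B C * (t' * area2 A B C))); [|ring].
    rewrite Hg1. ring. }
  assert (Es : s * rg = s' * rv).
  { apply eq_of_sq_eq; [apply Rmult_le_pos; lra..|].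
    apply (Rmult_eq_reg_r (area2 A B C * area2 A B C)); [|assumption].
    transitivity (rg * rg * (- (s * area2 A B C) * - (s * area2 A B C))); [ring|].
    rewrite Hv2.
    transitivity (rv * rv * (- (s' * area2 A B C) * - (s' * area2 A B C))); [|ring].
    rewrite Hg2. ring. }
  assert (Et' : t = t' * (rv / rg)).
  { apply (Rmult_eq_reg_r rg); [|lra]. rewrite Et; field; lra. }
  assert (Es' : s = s' * (rv / rg)).
  { apply (Rmult_eq_reg_r rg); [|lra]. rewrite Es; field; lra. }
  unfold lsub, lscale, affine; simpl; rewrite Et', Es'.
  f_equal; [f_equal|]; field; lra.
Qed.

(** This product is the power of [A] with respect to [g]. If it vanished, both sides would be the
    tangent to [g] at [A]. *)
Lemma vertex_outside g B A C :
  area2 A B C <> 0 -> inscribed g B A C ->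
  lor (lsub (A, 0) (cycle_of g)) (lsub (A, 0) (cycle_of g)) <> 0.
Proof.
  intros HD [H1 [H2 _]].
  destruct (area2_neq _ _ _ HD) as [HAB HAC].
  apply tangent_line_height in H1, H2; auto.
  pose proof (radius_gt0 g) as Hr.
  revert HD H1 H2 Hr; unfold area2, cycle_of, lor, lsub; simpl.
  destruct A as [ax ay], B as [bx b_y], C as [cx cy], (center g) as [x y]; simpl.
  set (r := radius g).
  set (p := bx - ax); set (q := b_y - ay); set (p' := cx - ax); set (q' := cy - ay).
  intros HD H1 H2 Hr HN.
  (* Both sides would be orthogonal to the line from A to the center. *)
  assert (Hdot : forall p q, (p * (y - ay) - q * (x - ax)) * (p * (y - ay) - q * (x - ax))
            = r * r * (p * p + q * q) -> p * (x - ax) + q * (y - ay) = 0).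
  { clear - HN; intros p q E. apply Rsqr_0_uniq; unfold Rsqr.
    transitivity ((p * p + q * q) * ((ax - x) * (ax - x) + (ay - y) * (ay - y))
      - (p * (y - ay) - q * (x - ax)) * (p * (y - ay) - q * (x - ax))); [ring|].
    rewrite E. replace ((ax - x) * (ax - x) + (ay - y) * (ay - y)) with (r * r) by lra. ring. }
  apply Hdot in H1, H2.
  apply HD, (Rmult_eq_reg_r (r * r)); [|nra].
  replace (r * r) with ((ax - x) * (ax - x) + (ay - y) * (ay - y)) by lra.
  transitivity ((p * (x - ax) + q * (y - ay)) * (q' * (x - ax) - p' * (y - ay))
    - (p' * (x - ax) + q' * (y - ay)) * (q * (x - ax) - p * (y - ay))); [ring|].
  rewrite H1, H2; ring.
Qed.

(** Differences of the three vectors have third coordinate 0 and span the plane, which kills the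
    planar part of [x]; then [radius g] being nonzero kills the rest. *)
Lemma vertices_span A B C g :
  area2 A B C <> 0 ->
  spans (lsub (A, 0) (cycle_of g)) (lsub (B, 0) (cycle_of g)) (lsub (C, 0) (cycle_of g)).
Proof.
  intros HD [[x y] z]; unfold cycle_of, lor, lsub; simpl.
  pose proof (radius_gt0 g) as Hr.
  destruct A as [ax ay], B as [bx b_y], C as [cx cy], (center g) as [gx gy].
  revert HD; unfold area2; simpl; intros HD H1 H2 H3.
  assert (E1 : (bx - ax) * x + (b_y - ay) * y = 0) by lra.
  assert (E2 : (cx - ax) * x + (cy - ay) * y = 0) by lra.
  assert (Hx : x = 0).
  { apply (Rmult_eq_reg_r ((bx - ax) * (cy - ay) - (b_y - ay) * (cx - ax))); auto.
    transitivity (((bx - ax) * x + (b_y - ay) * y) * (cy - ay)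
      - ((cx - ax) * x + (cy - ay) * y) * (b_y - ay)); [ring|rewrite E1, E2; ring]. }
  assert (Hy : y = 0).
  { apply (Rmult_eq_reg_r ((bx - ax) * (cy - ay) - (b_y - ay) * (cx - ax))); auto.
    transitivity (((cx - ax) * x + (cy - ay) * y) * (bx - ax)
      - ((bx - ax) * x + (b_y - ay) * y) * (cx - ax)); [ring|rewrite E1, E2; ring]. }
  subst x y.
  assert (z = 0) by (apply (Rmult_eq_reg_l (radius g)); lra).
  now subst.
Qed.

(** * Translating tangency into isotropy *)

Lemma lsub_lsub_lsub u v o : lsub (lsub u o) (lsub v o) = lsub u v.
Proof. unfold lsub; simpl; f_equal; [f_equal|]; ring. Qed.

Lemma externally_tangent_isotropic v w :
  externally_tangent v w -> isotropic (lsub (cycle_of v) (center w, - radius w)).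
Proof.
  unfold externally_tangent, isotropic, lsub, lor, cycle_of; simpl; intro H.
  rewrite <- pdist_sq, H; ring.
Qed.

Lemma internally_tangent_isotropic v W :
  internally_tangent v W -> isotropic (lsub (cycle_of v) (cycle_of W)).
Proof.
  unfold isotropic, lsub, lor, cycle_of; simpl; intros [_ H].
  pose proof (pdist_sq (center W) (center v)) as E; rewrite H in E; lra.
Qed.

Lemma incircle_inscribed A B C g :
  (forall X, on_circle g X -> in_triangle A B C X) ->
  tangent_to_line g A B -> tangent_to_line g B C -> tangent_to_line g C A ->
  inscribed g B A C /\ inscribed g C B A /\ inscribed g A C B.
Proof.
  intros H H1 H2 H3.
  repeat split; auto using tangent_to_line_sym;
    intros X HX; destruct (H X HX) as (s & t & Hs & Ht & Hst & ->).
  - exists s, t; auto.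
  (* The barycentric weights of [A], [B], [C] are [1 - s - t], [s], [t]; each angle takes the two
     not at its vertex. *)
  - exists t, (1 - s - t); repeat split; [lra..|unfold affine; simpl; f_equal; ring].
  - exists (1 - s - t), s; repeat split; [lra..|unfold affine; simpl; f_equal; ring].
Qed.

(** With the origin at [g], [lscale t u] is the cycle of [v] by [inscribed_homothetic], and likewise
    for [t'] and [v']. *)
Lemma vertex_tangencies g w B A C v v' W W' :
  area2 A B C <> 0 -> inscribed g B A C -> smaller_larger_tangent w B A C v v' ->
  internally_tangent v W -> internally_tangent v' W' ->
  let u := lsub (A, 0) (cycle_of g) in
  let p := lsub (center w, - radius w) (cycle_of g) in
  let t := 1 - radius v / radius g in
  let t' := 1 - radius v' / radius g in
  lor u u <> 0 /\ t <> t' /\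
  isotropic (lsub (lscale t u) p) /\ isotropic (lsub (lscale t' u) p) /\
  isotropic (lsub (lscale t u) (lsub (cycle_of W) (cycle_of g))) /\
  isotropic (lsub (lscale t' u) (lsub (cycle_of W') (cycle_of g))).
Proof.
  intros HD Hg [[H1 [H2 [H3 H4]]] [[H1' [H2' [H3' H4']]] Hlt]] HW HW' u p t t'.
  split; [now apply vertex_outside with B C|].
  split.
  { unfold t, t'; intro E.
    assert (E' : radius v / radius g = radius v' / radius g) by lra.
    pose proof (radius_gt0 g).
    apply Rmult_eq_reg_r in E'; [lra|apply Rinv_neq_0_compat; lra]. }
  unfold u, p, t, t'.
  rewrite <- !(inscribed_homothetic _ g B A C HD) by (unfold inscribed; auto).
  rewrite !lsub_lsub_lsub.
  repeat split; auto using externally_tangent_isotropic, internally_tangent_isotropic.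
Qed.

(** Parameter 0 means that the circle is [g] itself, so two zeros would make [v1] and [v2]
    coincide. *)
Lemma parameters_not_both0 g v1 v2 B1 A1 C1 B2 A2 C2 :
  area2 A1 B1 C1 <> 0 -> area2 A2 B2 C2 <> 0 ->
  inscribed g B1 A1 C1 -> inscribed g B2 A2 C2 ->
  inscribed v1 B1 A1 C1 -> inscribed v2 B2 A2 C2 ->
  distinct_circles v1 v2 ->
  ~ (1 - radius v1 / radius g = 0 /\ 1 - radius v2 / radius g = 0).
Proof.
  intros HD1 HD2 Hg1 Hg2 Hv1 Hv2 Hd [E1 E2].
  pose proof (inscribed_homothetic _ _ _ _ _ HD1 Hv1 Hg1) as F1.
  pose proof (inscribed_homothetic _ _ _ _ _ HD2 Hv2 Hg2) as F2.
  rewrite E1 in F1; rewrite E2 in F2.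
  assert (Z : forall u, lscale 0 u = (0, 0, 0))
    by (intro; unfold lscale; now rewrite !Rmult_0_l).
  rewrite Z in F1, F2; apply lsub_eq0 in F1, F2.
  rewrite <- F2 in F1; injection F1 as G1 G2.
  destruct Hd; auto.
Qed.

Lemma on_line_of_homothety I O1 O2 k :
  k <> 1 -> fst O2 - fst I = k * (fst O1 - fst I) ->
  (* The witness comes from solving for the homothety center: [I = (O2 - k O1) / (1 - k)]. *)
  snd O2 - snd I = k * (snd O1 - snd I) -> on_line I O1 O2.
Proof.
  intros Hk H1 H2; exists (/ (1 - k)).
  destruct I as [x y]; simpl in *.
  replace (fst O2) with (x + k * (fst O1 - x)) by lra.
  replace (snd O2) with (y + k * (snd O1 - y)) by lra.
  f_equal; field; lra.
Qed.

Theorem corollary4p2 :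
  forall (A B C I : point) (w wa wb wc wa' wb' wc' W1 W2 : circle),
    is_triangle A B C ->
    is_incenter A B C I ->
    inside_triangle A B C (center w) ->
    smaller_larger_tangent w B A C wa wa' ->
    smaller_larger_tangent w C B A wb wb' ->
    smaller_larger_tangent w A C B wc wc' ->
    outer_apollonius W1 wa wb wc ->
    outer_apollonius W2 wa' wb' wc' ->
    on_line I (center W1) (center W2).
Proof.
  intros A B C I w wa wb wc wa' wb' wc' W1 W2 HT [g [HI [Hin [T1 [T2 T3]]]]] _
    Ha Hb Hc [[D1 [D2 D3]] [Ia [Ib Ic]]] [[D1' [D2' D3']] [Ia' [Ib' Ic']]].
  subst I.
  destruct (incircle_inscribed _ _ _ _ Hin T1 T2 T3) as [Ga [Gb Gc]].
  pose proof (triangle_area _ _ _ HT) as HA.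
  assert (HB : area2 B C A <> 0) by now rewrite area2_rot.
  assert (HC : area2 C A B <> 0) by now rewrite area2_rot.
  destruct (vertex_tangencies g w B A C wa wa' W1 W2) as (? & ? & ? & ? & ? & ?); auto.
  destruct (vertex_tangencies g w C B A wb wb' W1 W2) as (? & ? & ? & ? & ? & ?); auto.
  destruct (vertex_tangencies g w A C B wc wc' W1 W2) as (? & ? & ? & ? & ? & ?); auto.
  assert (J : forall w B A C v v', smaller_larger_tangent w B A C v v' ->
            inscribed v B A C /\ inscribed v' B A C).
  { intros ? ? ? ? ? ? [(? & ? & ? & _) [(? & ? & ? & _) _]]; unfold inscribed; auto. }
  apply J in Ha as [Ja Ja'], Hb as [Jb Jb'], Hc as [Jc Jc'].
  (* The signed radii have opposite signs: [radius W] is positive, [- radius w] negative. *)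
  assert (Hne : forall W, lsub (cycle_of W) (cycle_of g)
                  <> lsub (center w, - radius w) (cycle_of g)).
  { intros W E; injection E as _ _ E; simpl in E.
    pose proof (radius_gt0 W); pose proof (radius_gt0 w); lra. }
  destruct (apollonius_inverse
    (lsub (A, 0) (cycle_of g)) (lsub (B, 0) (cycle_of g)) (lsub (C, 0) (cycle_of g))
    (lsub (center w, - radius w) (cycle_of g))
    (lsub (cycle_of W1) (cycle_of g)) (lsub (cycle_of W2) (cycle_of g))
    (1 - radius wa / radius g) (1 - radius wb / radius g) (1 - radius wc / radius g)
    (1 - radius wa' / radius g) (1 - radius wb' / radius g) (1 - radius wc' / radius g))
    as [k [Hk E]]; try assumption; auto using vertices_span;
    try (apply parameters_not_both0 with B A C C B A; assumption);
    try (apply parameters_not_both0 with C B A A C B; assumption);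
    try (apply parameters_not_both0 with A C B B A C; assumption).
  injection E as E1 E2 _.
  now apply on_line_of_homothety with k.
Qed.
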